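(* Let $(S,d)$ be a separable and complete metric space. For every $\Gamma \subset \mathcal{P}^1(S)$, $$\mu_{\mathrm{UI}}(\Gamma) \leq \mu_{\mathrm{H},W}(\Gamma).$$ Moreover, this inequality becomes an equality if $\Gamma$ is tight.
   Context: $\mathcal{P}^1(S)$ is the set of Borel probability measures $P$ on $S$ with $\int_S d(a,\cdot)\,dP<\infty$ for some (equivalently all) $a\in S$. The Wasserstein metric on $\mathcal{P}^1(S)$ is $W(P,Q)=\inf_\pi\int_{S\times S}d(x,y)\,d\pi(x,y)$, the infimum over all Borel probability measures $\pi$ on $S\times S$ with first marginal $P$ and second marginal $Q$. By Kantorovich duality, $W(P,Q)=\sup_{f}\left|\int f\,dP-\int f\,dQ\right|$, the supremum over all $f:S\to\mathbb{R}$ with $|f(x)-f(y)|\le d(x,y)$ for all $x,y\in S$. The relative Hausdorff measure of non-compactness for $W$ of $\Gamma\subset\mathcal{P}^1(S)$ is $$\mu_{\mathrm{H},W}(\Gamma)=\inf_{\substack{\Phi\subset\mathcal{P}^1(S)\\ \text{finite}}}\ \sup_{P\in\Gamma}\ \inf_{Q\in\Phi}W(P,Q)\in[0,\infty].$$ The measure of non-uniform integrability of $\Gamma$ is $$\mu_{\mathrm{UI}}(\Gamma)=\inf_{a\in S}\ \inf_{B}\ \sup_{P\in\Gamma}\int_{S\setminus B}d(a,\cdot)\,dP\in[0,\infty],$$ the second infimum taken over all bounded sets $B\subset S$. A set $\Gamma$ of Borel probability measures on $S$ is tight iff for each $\varepsilon>0$ there is a compact $K\subset S$ with $P(S\setminus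 K)<\varepsilon$ for each $P\in\Gamma$. *)

(* Defs.v *)
From HB Require Import structures.
From mathcomp Require Import all_boot all_order all_algebra.
From mathcomp Require Import all_classical all_reals all_analysis.

Set Implicit Arguments.
Unset Strict Implicit.
Unset Printing Implicit Defensive.

Import Order.TTheory GRing.Theory Num.Theory.
Import numFieldNormedType.Exports.

Local Open Scope classical_set_scope.
Local Open Scope ring_scope.

(* The join with [Complete] includes a distinguished point, so these are the
   nonempty complete metric spaces. *)
#[short(type="completeMetricType")]
HB.structure Definition CompleteMetric (R : numDomainType) :=
  {T of Complete T & Metric R T}.

Definition separable (T : topologicalType) : Prop :=
  exists2 D : set T, countable D & dense D.

Definition metric_bounded (R : numDomainType) (S : metricType R) (B : set S)
  : Prop :=
  exists M : R, forall x y, B x -> B y -> mdist x y <= M.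

Notation borel T := (g_sigma_algebraType (@open T)).

Notation borel_probability R T := (probability (borel T) R).

(* Supremum in the ordered set [0, +oo]: unlike [ereal_sup], its value on the
   empty set is 0. *)
Definition nonneg_sup (R : realType) (A : set (\bar R)) : \bar R :=
  ereal_sup (0%E |` A).

Definition finite_first_moment (R : realType) (S : completeMetricType R)
  : set (borel_probability R S) :=
  [set P : borel_probability R S |
     exists a : S, (\int[P]_x (mdist a x)%:E < +oo)%E].

(* The sigma-algebra on the product is the Borel one of the product topology.
   Marginals are compared on Borel sets only, because a library measure also
   carries arbitrary values on nonmeasurable sets. *)
Definition couplings (R : realType) (S : completeMetricType R)
    (P Q : borel_probability R S) : set (borel_probability R (S * S)%type) :=
  [set pi : borel_probability R (S * S)%type | forall A : set (borel S), measurable A ->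
     pi (fst @^-1` A) = P A /\ pi (snd @^-1` A) = Q A].

Definition wasserstein (R : realType) (S : completeMetricType R)
    (P Q : borel_probability R S) : \bar R :=
  ereal_inf [set (\int[pi]_z (mdist z.1 z.2)%:E)%E | pi in couplings P Q].

Definition hausdorff_noncompactness (R : realType) (S : completeMetricType R)
    (Gamma : set (borel_probability R S)) : \bar R :=
  ereal_inf
    [set nonneg_sup
           [set ereal_inf [set wasserstein P Q | Q in Phi] | P in Gamma]
    | Phi in [set Phi : set (borel_probability R S) |
                finite_set Phi /\ Phi `<=` @finite_first_moment R S]].

(* [B] ranges over the bounded Borel sets, so that the integral over the
   complement of [B] makes sense.  Every bounded set is contained in a closed
   ball, so this does not affect the infimum. *)
Definition nonuniform_integrability (R : realType) (S : completeMetricType R)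
    (Gamma : set (borel_probability R S)) : \bar R :=
  ereal_inf (range (fun a : S =>
    ereal_inf
      [set nonneg_sup
             [set (\int[P]_(x in ~` B) (mdist a x)%:E)%E | P in Gamma]
      | B in [set B : set (borel S) | metric_bounded B /\ measurable B]])).

Definition tight (R : realType) (S : completeMetricType R)
    (Gamma : set (borel_probability R S)) : Prop :=
  forall e : R, 0 < e -> exists2 K : set S, compact K &
    forall P, Gamma P -> (P (~` K) < e%:E)%E.

(* Main.v *)
Require Import Defs.
From HB Require Import structures.
From mathcomp Require Import all_boot all_order all_algebra.
From mathcomp Require Import all_classical all_reals all_analysis.
From mathcomp Require Import finmap measurable_realfun ring lra.

(** Both inequalities are proved by looking directly at couplings.

    Lower bound.  Suppose that every P in Gamma is within h of a finite set
    Phi of measures with finite first moment.  The functions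
    (d(a,.) - r)^+ are 1-Lipschitz, so a coupling of P and Q gives
    int (d(a,.) - r)^+ dP <= int (d(a,.) - r)^+ dQ + W(P,Q), and Phi being
    finite, one r makes the first term on the right small for all Q in Phi
    ([finite_uniform_excess]).  The left-hand side is not yet the tail
    integral of d(a,.), but outside a ball whose radius is much larger than r
    the quotient d / (d - r) is close to 1, so the tail of P over the
    complement of that ball is at most h plus an arbitrarily small amount
    ([coupling_tail_le]).

    Upper bound under tightness.  Let B be bounded with tails
    int_(~B) d(a,.) dP <= u for all P in Gamma.  By tightness, up to a part of
    small mass the set B is covered by finitely many small balls.  Cut B along
    these balls into pieces A_k with centres y_k, add the remainder of the
    space as a last piece, and move each P to the points y_k, the remainder
    going to a.  Small balls cost little, ~B costs at most u, and the part of
    B that is missed costs at most (radius of B) * (small mass).  To reach only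
    finitely many target measures, the masses P(A_k) are rounded down to
    multiples of 1/N and the surplus, at most 1/N per piece, is sent to a as
    well.  The resulting transport plan is [rounding_plan]; its second marginal
    depends on P only through the rounded masses ([rounding_plan_coupling]),
    hence takes finitely many values.  Thus every P in Gamma is within
    u + epsilon of a finite set of measures ([finite_quantization]). *)

Set Implicit Arguments.
Unset Strict Implicit.
Unset Printing Implicit Defensive.

Import Order.TTheory GRing.Theory Num.Theory.
Import numFieldNormedType.Exports.

Local Open Scope classical_set_scope.
Local Open Scope ring_scope.

(** * Borel measurability of the distance and of projections *)

(** Stated for generating families rather than for topologies, so that it also
    serves for maps into and out of S * S with the Borel sigma-algebra of the
    product topology. *)
Lemma measurable_fun_generated (T U : pointedType) (G : set (set T))
    (H : set (set U)) (f : T -> U) :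
  (forall B, H B -> G (f @^-1` B)) ->
  measurable_fun [set: g_sigma_algebraType G]
    (f : g_sigma_algebraType G -> g_sigma_algebraType H).
Proof.
move=> Gf; refine (@measurability _ _ (g_sigma_algebraType G)
  (g_sigma_algebraType H) setT f H _ _) => //.
move=> _ [B HB <-]; rewrite setTI.
by apply: sub_sigma_algebra; exact: Gf.
Qed.

Lemma measurable_fun_borel_real (R : realType) (T : pointedType)
    (G : set (set T)) (f : T -> R) :
  (forall B : set R, open B -> G (f @^-1` B)) ->
  measurable_fun [set: g_sigma_algebraType G] (f : g_sigma_algebraType G -> R).
Proof.
move=> Gf; apply: (measurability _ (RGenOInfty.measurableE R)) => //.
move=> _ [_ [a ->] <-]; rewrite setTI.
by apply: sub_sigma_algebra; apply: Gf; exact: interval_open.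
Qed.

Lemma open_borel_measurable (T : ptopologicalType) (A : set T) :
  open A -> measurable (A : set (borel T)).
Proof. exact: sub_sigma_algebra. Qed.

Lemma continuous_mdist (R : realType) (S : completeMetricType R) :
  continuous (fun z : S * S => mdist z.1 z.2).
Proof.
move=> -[x y]; apply/cvgrPdist_lt => e e0.
exists (ball x (e / 2), ball y (e / 2)) => /=.
  by split; apply: nbhsx_ballx; rewrite divr_gt0.
move=> [u v] /= [].
rewrite !ballEmdist/= => xu yv.
have h1 := metric_triangle x u y; have h2 := metric_triangle u v y.
have h3 := metric_triangle u x v; have h4 := metric_triangle x y v.
move: h1 h2 h3 h4 xu yv.
rewrite (metric_sym v y) (metric_sym u x) ltr_norml; lra.
Qed.

Lemma continuous_mdistl (R : realType) (S : completeMetricType R) (a : S) :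
  continuous (mdist a).
Proof.
move=> x; apply: (@continuous_comp _ _ _ (pair a)
  (fun z : S * S => mdist z.1 z.2)).
  by apply: cvg_pair; [exact: cvg_cst|exact: cvg_id].
exact: continuous_mdist.
Qed.

Lemma measurable_mdist (R : realType) (S : completeMetricType R) :
  measurable_fun [set: borel (S * S)%type]
    (fun z : borel (S * S)%type => (mdist z.1 z.2)%:E).
Proof.
apply/measurable_EFinP; apply: measurable_fun_borel_real.
exact/continuousP/continuous_mdist.
Qed.

Lemma measurable_mdistl (R : realType) (S : completeMetricType R) (a : S) :
  measurable_fun [set: borel S] (fun x : borel S => (mdist a x)%:E).
Proof.
apply/measurable_EFinP; apply: measurable_fun_borel_real.
exact/continuousP/continuous_mdistl.
Qed.

Lemma measurable_fst_borel (T : ptopologicalType) :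
  measurable_fun [set: borel (T * T)%type]
    (fst : borel (T * T)%type -> borel T).
Proof.
by apply: measurable_fun_generated; apply/continuousP => z; exact: cvg_fst.
Qed.

Lemma measurable_snd_borel (T : ptopologicalType) :
  measurable_fun [set: borel (T * T)%type]
    (snd : borel (T * T)%type -> borel T).
Proof.
by apply: measurable_fun_generated; apply/continuousP => z; exact: cvg_snd.
Qed.

Local Open Scope ereal_scope.

(** * Integration along couplings *)

Lemma coupling_integral_fst (R : realType) (S : completeMetricType R)
    (P Q : borel_probability R S) pi (f : borel S -> \bar R) :
  couplings P Q pi -> measurable_fun [set: borel S] f -> (forall x, 0 <= f x) ->
  \int[P]_x f x = \int[pi]_z f z.1.
Proof.
move=> cpl mf f0.
rewrite -(@ge0_integral_pushforward _ _ _ _ _ _ (@measurable_fst_borel S)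
  pi setT _ measurableT)//.
apply: eq_measure_integral => [|mfst A mA _]; first exact: measurable_fst_borel.
by case: (cpl A mA) => e _; exact: (esym e).
Qed.

Lemma coupling_integral_snd (R : realType) (S : completeMetricType R)
    (P Q : borel_probability R S) pi (f : borel S -> \bar R) :
  couplings P Q pi -> measurable_fun [set: borel S] f -> (forall x, 0 <= f x) ->
  \int[Q]_x f x = \int[pi]_z f z.2.
Proof.
move=> cpl mf f0.
rewrite -(@ge0_integral_pushforward _ _ _ _ _ _ (@measurable_snd_borel S)
  pi setT _ measurableT)//.
apply: eq_measure_integral => [|msnd A mA _]; first exact: measurable_snd_borel.
by case: (cpl A mA) => _ e; exact: (esym e).
Qed.

(** By the triangle inequality, the choice of centre changes the first moment
    by at most a constant. *)
Lemma finite_first_moment_center (R : realType) (S : completeMetricType R)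
    (P : borel_probability R S) (a : S) :
  finite_first_moment P -> \int[P]_x (mdist a x)%:E < +oo.
Proof.
case=> b Pb.
apply: (@le_lt_trans _ _ (\int[P]_x ((mdist a b)%:E + (mdist b x)%:E))).
  apply: ge0_le_integral => //.
  - by move=> x _; rewrite lee_fin mdist_ge0.
  - exact: measurable_mdistl.
  - by apply: emeasurable_funD => //; exact: measurable_mdistl.
  - by move=> x _; rewrite -EFinD lee_fin metric_triangle.
rewrite ge0_integralD//.
- by rewrite lte_add_pinfty// integral_cst//= probability_setT mule1 ltry.
- by move=> x _; rewrite lee_fin mdist_ge0.
- by move=> x _; rewrite lee_fin mdist_ge0.
- exact: measurable_mdistl.
Qed.

(** * Tails of measures close to a finite set *)

Lemma measurable_mdist_excess (R : realType) (S : completeMetricType R) (a : S)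
    (r : R) :
  measurable_fun [set: borel S]
    (fun x : borel S => (Num.max 0 (mdist a x - r))%:E).
Proof.
apply/measurable_EFinP; apply: measurable_maxr => //.
apply: measurable_funB => //.
by apply/measurable_EFinP; exact: measurable_mdistl.
Qed.

Lemma measurable_mdist_le (R : realType) (S : completeMetricType R) (a : S)
    (t : R) :
  measurable [set x : borel S | (mdist a x <= t)%R].
Proof.
have := @measurable_mdistl R S a measurableT [set s | s <= t%:E].
by rewrite setTI; apply; exact: emeasurable_itv `]-oo, _]%R.
Qed.

(** Dominated convergence: the excess over n vanishes at x once n >= d(a,x), and
    is dominated by d(a,.), which is integrable. *)
Lemma mdist_excess_cvg0 (R : realType) (S : completeMetricType R)
    (P : borel_probability R S) (a : S) :
  finite_first_moment P ->
  \int[P]_x (Num.max 0 (mdist a x - n%:R))%:E @[n --> \oo] --> 0.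
Proof.
move=> P1; rewrite -[0](integral0 P setT).
have d0 (x : S) : (0 <= mdist a x)%R by exact: mdist_ge0.
apply: (@dominated_cvg _ _ _ P setT measurableT _ _
  (fun x : borel S => (mdist a x)%:E)).
- by move=> n; exact: measurable_mdist_excess.
- move=> x _; apply: cvg_near_cst.
  near=> n; congr EFin; apply/max_idPl; rewrite subr_le0.
  by near: n; exact: nbhs_infty_ger.
- by [].
- apply/integrableP; split; first exact: measurable_mdistl.
  under eq_integral do rewrite abse_EFin ger0_norm//.
  exact: finite_first_moment_center.
- move=> n x _; rewrite lee_fin ger0_norm ?le_max ?lexx// ge_max d0/=.
  by rewrite lerBlDr lerDl.
Unshelve. all: by end_near. Qed.

Lemma finite_uniform_excess (R : realType) (S : completeMetricType R)
    (Phi : set (borel_probability R S)) (a : S) (e : R) :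
  finite_set Phi -> Phi `<=` @finite_first_moment R S -> (0 < e)%R ->
  exists n : nat, forall Q, Phi Q ->
    \int[Q]_x (Num.max 0 (mdist a x - n%:R))%:E < e%:E.
Proof.
move=> finPhi Phi1 e0.
have : \forall n \near \oo, (\bigcap_(Q in [set` fset_set Phi])
    [set n | \int[Q]_x (Num.max 0 (mdist a x - n%:R))%:E < e%:E]) n.
  apply: filter_bigI => Q; rewrite in_fset_set// => /set_mem/Phi1 Q1.
  have /fine_cvgP[fn] := mdist_excess_cvg0 a Q1.
  move=> /cvgrPdist_lt/(_ _ e0) h; near=> n.
  have fnn : \int[Q]_x (Num.max 0 (mdist a x - n%:R))%:E \is a fin_num.
    by near: n.
  rewrite /= -(fineK fnn) lte_fin (le_lt_trans (ler_norm _))//.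
  by rewrite -normrN -[(- _)%R]add0r; near: n.
move=> [n _ /(_ n (leqnn n))] h; exists n => Q PhiQ.
by apply: h; rewrite /= in_fset_set//; exact: mem_set.
Unshelve. all: by end_near. Qed.

(** The radius r (1 + dl) / dl is the point beyond which t <= (1 + dl) (t - r).
    Applied to t = d(a,x), and combined with the 1-Lipschitz bound
    d(a,x) - r <= (d(a,y) - r)^+ + d(x,y), this bounds the tail of the first
    marginal pointwise on S * S. *)
Lemma coupling_tail_le (R : realType) (S : completeMetricType R)
    (P Q : borel_probability R S) pi (a : S) (r dl : R) :
  couplings P Q pi -> (0 <= r)%R -> (0 < dl)%R ->
  \int[P]_(x in ~` [set x : borel S | (mdist a x <= r * (1 + dl) / dl)%R])
      (mdist a x)%:E <=
  (1 + dl)%:E * (\int[Q]_x (Num.max 0 (mdist a x - r))%:E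
                 + \int[pi]_z (mdist z.1 z.2)%:E).
Proof.
move=> cpl r0 dl0.
set B := [set x | _].
have mB : measurable B by exact: measurable_mdist_le.
have e0 (x : S) : (0 <= Num.max 0 (mdist a x - r))%R by rewrite le_max lexx.
have d0 (x y : S) : (0 <= mdist x y)%R by exact: mdist_ge0.
have mtail : measurable_fun [set: borel S]
    ((fun x : borel S => (mdist a x)%:E) \_ (~` B)).
  apply/(measurable_restrictT _ _).1; first exact: measurableC.
  exact: measurable_funTS (measurable_mdistl a).
have tail0 x : 0 <= ((fun x : borel S => (mdist a x)%:E) \_ (~` B)) x.
  by apply: erestrict_ge0 => ? _; rewrite lee_fin.
have mexc : measurable_fun [set: borel (S * S)%type]
    (fun z : borel (S * S)%type => (Num.max 0 (mdist a z.2 - r))%:E).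
  exact: measurableT_comp (measurable_mdist_excess a r)
    (@measurable_snd_borel S).
have mdst := @measurable_mdist R S.
have exc0 (z : S * S) : 0 <= (Num.max 0 (mdist a z.2 - r))%:E.
  by rewrite lee_fin.
have dst0 (z : S * S) : 0 <= (mdist z.1 z.2)%:E by rewrite lee_fin.
rewrite integral_mkcond (coupling_integral_fst cpl mtail tail0).
rewrite (coupling_integral_snd cpl (measurable_mdist_excess a r)); last first.
  by move=> x; rewrite lee_fin.
rewrite -(ge0_integralD pi measurableT (fun z _ => exc0 z) mexc
  (fun z _ => dst0 z) mdst).
have dl1 : (0 <= 1 + dl)%R by rewrite addr_ge0// ltW.
have msum := emeasurable_funD mexc mdst.
rewrite -(ge0_integralZl_EFin pi measurableT _ msum dl1); last first.
  by move=> z _; rewrite adde_ge0.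
apply: ge0_le_integral => /=; first exact: measurableT.
- by move=> z _; exact: tail0.
- exact: measurableT_comp mtail (@measurable_fst_borel S).
- exact: measurable_funeM msum.
move=> [x y] _; rewrite /patch/=; case: ifPn => [|_]; last first.
  by rewrite mule_ge0// ?adde_ge0// lee_fin.
move=> /set_mem/negP; rewrite -ltNge => tx.
rewrite -EFinD -EFinM lee_fin.
have h : (mdist a x - r <= Num.max 0 (mdist a y - r) + mdist x y)%R.
  have := metric_triangle a y x; rewrite (metric_sym y x) => h1.
  have : (mdist a y - r <= Num.max 0 (mdist a y - r))%R.
    by rewrite le_max lexx orbT.
  lra.
apply: le_trans (ler_wpM2l _ h); last by rewrite addr_ge0// ltW.
move: tx; rewrite ltr_pdivrMr//; nra.
Qed.

(** * The lower bound *)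

Lemma nonneg_sup_ge0 (R : realType) (A : set (\bar R)) : 0 <= nonneg_sup A.
Proof. by apply: ereal_sup_ubound; left. Qed.

Lemma nonneg_sup_ub (R : realType) (A : set (\bar R)) x :
  A x -> x <= nonneg_sup A.
Proof. by move=> Ax; apply: ereal_sup_ubound; right. Qed.

Lemma nonneg_sup_le (R : realType) (A : set (\bar R)) y :
  0 <= y -> (forall x, A x -> x <= y) -> nonneg_sup A <= y.
Proof. by move=> y0 Ay; apply: ge_ereal_sup => x [->//|/Ay]. Qed.

Lemma nonuniform_integrability_le_hausdorff (R : realType)
    (S : completeMetricType R) (Gamma : set (borel_probability R S)) :
  nonuniform_integrability Gamma <= hausdorff_noncompactness Gamma.
Proof.
apply: le_ereal_inf_tmp => _ [Phi [finPhi Phi1] <-].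
set h := nonneg_sup _.
have := nonneg_sup_ge0 _ : 0 <= h.
have hub P : Gamma P -> ereal_inf [set wasserstein P Q | Q in Phi] <= h.
  by move=> GP; apply: nonneg_sup_ub; exists P.
case: h hub => [c| |] hub //; last by move=> _; rewrite leey.
rewrite lee_fin => c0.
apply/lee_addgt0Pr => e e0.
pose a : S := point.
have e4 : (0 < e / 4)%R by rewrite divr_gt0.
have [n excn] := finite_uniform_excess a finPhi Phi1 e4.
(* [dl] solves (1 + dl) (c + e / 2) = c + e. *)
pose dl := (e / 2 / (c + e / 2))%R.
have e2 : (0 < e / 2)%R by rewrite divr_gt0.
have ce : (0 < c + e / 2)%R by rewrite ltr_wpDl.
have dl0 : (0 < dl)%R by rewrite divr_gt0.
have n0 : (0 <= n%:R :> R)%R by [].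
pose B := [set x : borel S | (mdist a x <= n%:R * (1 + dl) / dl)%R].
have mB : measurable B by exact: measurable_mdist_le.
have bB : @metric_bounded R S B.
  exists (n%:R * (1 + dl) / dl + n%:R * (1 + dl) / dl)%R => x y Bx By.
  rewrite (le_trans (metric_triangle x a y))// lerD//.
  by rewrite metric_sym.
apply: (@le_trans _ _
    (nonneg_sup [set \int[P]_(x in ~` B) (mdist a x)%:E | P in Gamma])).
  apply: ge_ereal_inf; eexists; first by exists a.
  by apply: ge_ereal_inf; eexists; first by exists B.
apply: nonneg_sup_le => [|_ [P GP <-]]; first by rewrite lee_fin addr_ge0// ltW.
have : ereal_inf [set wasserstein P Q | Q in Phi] < (c + e / 4)%:E.
  by rewrite (le_lt_trans (hub P GP))// lte_fin ltrDl.
move=> /ereal_inf_lt[_ [Q PhiQ <-]] /ereal_inf_lt[_ [pi cpl <-]] cost.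
apply: (le_trans (coupling_tail_le a cpl n0 dl0)).
rewrite -EFinD (_ : c + e = (1 + dl) * (e / 4 + (c + e / 4)))%R; last first.
  by rewrite /dl; field; rewrite gt_eqF//; lra.
rewrite EFinM lee_pmul2l// ?EFinD ?lte_fin ?addr_gt0//.
by apply: leeD; apply: ltW => //; exact: excn.
Qed.

(** * Plans that split the mass of each piece between two points *)

Section transport_to_point.
Context (R : realType) (S : completeMetricType R).
Variables (mu : {measure set (borel S) -> \bar R}) (y : S).

(** The measure mu (x) delta_y. *)
Definition transport : set (borel (S * S)%type) -> \bar R :=
  pushforward mu (fun x : borel S => (x, y) : borel (S * S)%type).

Lemma measurable_pair_borel :
  measurable_fun [set: borel S]
    (fun x : borel S => (x, y) : borel (S * S)%type).
Proof.
apply: measurable_fun_generated; apply/continuousP => x.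
by apply: cvg_pair; [exact: cvg_id|exact: cvg_cst].
Qed.

Let transport0 : transport set0 = 0.
Proof. by rewrite /transport /pushforward preimage_set0 measure0. Qed.

Let transport_ge0 A : 0 <= transport A.
Proof. exact: (measure_ge0 mu). Qed.

Let transport_sigma_additive : semi_sigma_additive transport.
Proof.
apply: measure_semi_sigma_additive; exact: measurable_pair_borel.
Qed.

HB.instance Definition _ := isMeasure.Build _ _ _ transport
  transport0 transport_ge0 transport_sigma_additive.

Lemma ge0_integral_transport (f : borel (S * S)%type -> \bar R) :
  measurable_fun [set: borel (S * S)%type] f -> (forall z, 0 <= f z) ->
  \int[transport]_z f z = \int[mu]_x f (x, y).
Proof.
move=> mf f0.
by rewrite /transport (ge0_integral_pushforward measurable_pair_borel).
Qed.

End transport_to_point.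

Lemma ge0_integral_mrestr d (T : measurableType d) (R : realType)
    (mu : {measure set T -> \bar R}) (D : set T) (mD : measurable D)
    (f : T -> \bar R) :
  measurable_fun [set: T] f -> (forall x, 0 <= f x) ->
  \int[mrestr mu mD]_x f x = \int[mu]_(x in D) f x.
Proof.
move=> mf f0.
rewrite [LHS](ge0_negligible_integral (measurableC mD))//; last first.
  by rewrite /= /mrestr setICl measure0.
rewrite setTD setCK; apply: eq_measure_integral => A mA AD.
by rewrite /= /mrestr setIidl.
Qed.

Section splitting_plan.
Context (R : realType) (S : completeMetricType R).
Variables (P : borel_probability R S) (A : nat -> set (borel S)).
Variables (mA : forall k, measurable (A k)) (m : nat) (y : nat -> S) (a : S).
Variables (keep move : nat -> {nonneg R}).

(** From each piece A_k, the fraction [keep k] of the mass of P goes to y_k and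
    the fraction [move k] goes to a. *)
Definition splitting_plan : set (borel (S * S)%type) -> \bar R :=
  measure_add
    (msum (fun k => mscale (keep k) (transport (mrestr P (mA k)) (y k))) m)
    (msum (fun k => mscale (move k) (transport (mrestr P (mA k)) a)) m).

HB.instance Definition _ := Measure.on splitting_plan.

Lemma splitting_planE C : splitting_plan C =
  \sum_(k < m) (keep k)%:num%:E * P ([set x | C (x, y k)] `&` A k) +
  \sum_(k < m) (move k)%:num%:E * P ([set x | C (x, a)] `&` A k).
Proof. by rewrite /splitting_plan measure_addE. Qed.

Lemma ge0_integral_splitting_plan (f : borel (S * S)%type -> \bar R) :
  measurable_fun [set: borel (S * S)%type] f -> (forall z, 0 <= f z) ->
  \int[splitting_plan]_z f z =
  \sum_(k < m) (keep k)%:num%:E * \int[P]_(x in A k) f (x, y k) +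
  \sum_(k < m) (move k)%:num%:E * \int[P]_(x in A k) f (x, a).
Proof.
move=> mf f0.
have piece (c : {nonneg R}) k z :
    \int[mscale c (transport (mrestr P (mA k)) z)]_w f w =
    c%:num%:E * \int[P]_(x in A k) f (x, z).
  rewrite ge0_integral_mscale// ge0_integral_transport// ge0_integral_mrestr//.
  exact: measurableT_comp mf (measurable_pair_borel z).
rewrite /splitting_plan ge0_integral_measure_add//.
by rewrite !ge0_integral_measure_sum//; congr (_ + _);
  apply: eq_bigr => k _; rewrite piece.
Qed.

Hypothesis keep_move : forall k, ((keep k)%:num + (move k)%:num = 1)%R.
Hypothesis tA : trivIset [set: nat] A.
Hypothesis cA : \big[setU/set0]_(k < m) A k = setT.

(** The two fractions of each piece add up to the whole piece, and the pieces
    partition the space. *)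
Lemma splitting_plan_fst (C : set (borel S)) :
  measurable C -> splitting_plan (fst @^-1` C) = P C.
Proof.
move=> mC; rewrite splitting_planE -big_split/=.
transitivity (\sum_(k < m) P (C `&` A k)).
  apply: eq_bigr => k _.
  by rewrite -ge0_muleDl ?lee_fin// -EFinD keep_move mul1e.
rewrite -(measure_bigsetU P (F := fun k => C `&` A k)) => [|k|].
- by rewrite -big_distrr/= cA setIT.
- exact: measurableI.
- exact: trivIset_setIl.
Qed.

Let splitting_plan_setT : splitting_plan setT = 1.
Proof.
by rewrite -(preimage_setT fst) splitting_plan_fst// probability_setT.
Qed.

HB.instance Definition _ :=
  Measure_isProbability.Build _ _ _ splitting_plan splitting_plan_setT.

(** The same plan with its probability structure, which depends on the
    hypotheses above and so is bundled explicitly. *)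
Definition splitting_plan_probability : borel_probability R (S * S)%type :=
  splitting_plan.

End splitting_plan.

Section second_marginal.
Context (R : realType) (S : completeMetricType R).

Definition second_marginal (pi : borel_probability R (S * S)%type) :
    borel_probability R S :=
  distribution pi (HB.pack_for {mfun borel (S * S)%type >-> borel S}
    (snd : borel (S * S)%type -> borel S)
    (isMeasurableFun.Build _ _ _ _ _ (@measurable_snd_borel S))).

Lemma second_marginalE pi C : second_marginal pi C = pi (snd @^-1` C).
Proof. by []. Qed.

End second_marginal.

(** * Rounding the masses of a partition *)

Section quantization.
Context (R : realType) (S : completeMetricType R).
Variables (A : nat -> set (borel S)) (mA : forall k, measurable (A k)).
Variables (m : nat) (y : nat -> S) (a : S).
Hypothesis tA : trivIset [set: nat] A.
Hypothesis cA : \big[setU/set0]_(k < m) A k = setT.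
Variable N : nat.
Implicit Type P : borel_probability R S.

Definition mass P k : R := fine (P (A k)).

Definition mass_level P k : nat := Num.trunc (N.+1%:R * mass P k).

Definition coarse_mass P k : R := ((mass_level P k)%:R / N.+1%:R)%R.

Lemma massE P k : P (A k) = (mass P k)%:E.
Proof. by rewrite fineK// fin_num_measure. Qed.

Lemma mass_ge0 P k : (0 <= mass P k)%R.
Proof. by rewrite fine_ge0// measure_ge0. Qed.

Lemma mass_level_le P k : (mass_level P k <= N.+1)%N.
Proof.
have p1 : (mass P k <= 1)%R by rewrite -lee_fin -massE probability_le1.
rewrite -(ler_nat R) (@le_trans _ _ (N.+1%:R * mass P k)%R)//.
  by rewrite truncn_le mulr_ge0// mass_ge0.
by rewrite ler_piMr.
Qed.

Lemma coarse_mass_ge0 P k : (0 <= coarse_mass P k)%R.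
Proof. by rewrite divr_ge0. Qed.

Lemma coarse_mass_le P k : (coarse_mass P k <= mass P k)%R.
Proof.
by rewrite ler_pdivrMr// mulrC truncn_le mulr_ge0// mass_ge0.
Qed.

Lemma mass_sub_coarse P k : (mass P k - coarse_mass P k <= N.+1%:R^-1)%R.
Proof.
have := truncn_itv (mulr_ge0 (ler0n R N.+1) (mass_ge0 P k)).
rewrite -/(mass_level P k) => /andP[_ h].
rewrite lerBlDr /coarse_mass -[X in (X + _)%R]mul1r -mulrDl ler_pdivlMr//.
by rewrite mulrC addrC natr1 ltW.
Qed.

Lemma keep_fraction_ge0 P k : (0 <= coarse_mass P k / mass P k)%R.
Proof. by rewrite divr_ge0// ?coarse_mass_ge0 ?mass_ge0. Qed.

Lemma move_fraction_ge0 P k : (0 <= 1 - coarse_mass P k / mass P k)%R.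
Proof.
have [p0|p0] := eqVneq (mass P k) 0%R; first by rewrite p0 invr0 mulr0 subr0.
rewrite subr_ge0 ler_pdivrMr ?mul1r ?coarse_mass_le//.
by rewrite lt_neqAle eq_sym p0 mass_ge0.
Qed.

Definition keep_fraction P k : {nonneg R} := NngNum (keep_fraction_ge0 P k).
Definition move_fraction P k : {nonneg R} := NngNum (move_fraction_ge0 P k).

Lemma keep_move P k :
  ((keep_fraction P k)%:num + (move_fraction P k)%:num = 1)%R.
Proof. by rewrite /= addrC subrK. Qed.

(** This includes pieces of mass 0, where the quotient defining the fraction is
    0 / 0 = 0: the rounded mass vanishes too. *)
Lemma keep_fractionE P k :
  ((keep_fraction P k)%:num * mass P k = coarse_mass P k)%R.
Proof.
rewrite /=; have [p0|p0] := eqVneq (mass P k) 0%R; last by rewrite divfK.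
apply/esym/eqP; rewrite p0 mulr0 eq_le coarse_mass_ge0 andbT.
by rewrite -p0 coarse_mass_le.
Qed.

Lemma move_fractionE P k :
  ((move_fraction P k)%:num * mass P k = mass P k - coarse_mass P k)%R.
Proof. by rewrite -[in RHS]keep_fractionE /= mulrBl mul1r. Qed.

Definition rounding_plan P : borel_probability R (S * S)%type :=
  @splitting_plan_probability R S P A mA m y a
    (keep_fraction P) (move_fraction P) (keep_move P) tA cA.

(** The masses P(A_k) enter only through their rounded values: what is sent
    to a is all that is not kept, that is 1 - sum_k (rounded mass of A_k). *)
Lemma rounding_plan_snd P (C : set (borel S)) :
  rounding_plan P (snd @^-1` C) =
  (\sum_(k < m) coarse_mass P k * \1_C (y k)
   + (1 - \sum_(k < m) coarse_mass P k) * \1_C a)%:E.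
Proof.
have slice (z : S) k : P ([set x | C z] `&` A k) = (\1_C z * mass P k)%:E.
  rewrite indicE; have [zC|zC] := boolP (z \in C).
    rewrite mul1r -massE; congr (P _); apply/seteqP; split=> [x []//|x Ax].
    by split=> //; exact: set_mem.
  rewrite mul0r (_ : _ `&` _ = set0) ?measure0//.
  apply/seteqP; split=> [x [Cz _]|//].
  by move/negP : zC; apply; exact: mem_set.
have total : (\sum_(k < m) mass P k = 1)%R.
  apply: EFin_inj; rewrite -sumEFin.
  under eq_bigr do rewrite -massE.
  by rewrite -(measure_bigsetU P mA tA) cA; exact: probability_setT.
rewrite [LHS]splitting_planE /=.
under eq_bigr do rewrite slice -EFinM mulrCA keep_fractionE mulrC.
under [X in _ + X]eq_bigr do rewrite slice -EFinM mulrCA move_fractionE mulrC.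
by rewrite !sumEFin -EFinD -mulr_suml sumrB total.
Qed.

(** This is what makes finitely many targets suffice: the plan for P ends in the
    target built from any P' with the same rounded masses. *)
Lemma rounding_plan_coupling P P' :
  (forall k, (k < m)%N -> mass_level P k = mass_level P' k) ->
  couplings P (second_marginal (rounding_plan P')) (rounding_plan P).
Proof.
move=> PP' C mC; split.
  exact: (splitting_plan_fst P mA y a (keep_move P) tA cA mC).
rewrite second_marginalE !rounding_plan_snd; congr EFin.
have cm (k : 'I_m) : coarse_mass P k = coarse_mass P' k.
  by rewrite /coarse_mass PP'.
by congr (_ + (1 - _) * _)%R; apply: eq_bigr => k _; rewrite cm.
Qed.

(** Sending a point of A_k to a instead of y_k costs at most r more, and this
    happens to a mass of at most 1 / (N + 1) in each piece. *)
Lemma rounding_plan_cost P (r : R) : (0 <= r)%R ->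
  (forall k, (k < m)%N ->
    forall x, A k x -> (mdist x a <= mdist x (y k) + r)%R) ->
  \int[rounding_plan P]_z (mdist z.1 z.2)%:E <=
  \sum_(k < m) \int[P]_(x in A k) (mdist x (y k))%:E
  + (m%:R * (r / N.+1%:R))%:E.
Proof.
move=> r0 yr.
have dm (z : S) D : measurable_fun D (fun x : borel S => (mdist x z)%:E).
  apply: measurable_funTS; under eq_fun do rewrite metric_sym.
  exact: measurable_mdistl.
have d0 (x z : S) : 0 <= (mdist x z)%:E by rewrite lee_fin mdist_ge0.
rewrite [leLHS]ge0_integral_splitting_plan; [|exact: measurable_mdist|by []].
rewrite -big_split/=.
have -> : (m%:R * (r / N.+1%:R))%:E = \sum_(k < m) (r / N.+1%:R)%:E.
  by rewrite sumEFin sumr_const card_ord mulr_natl.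
rewrite -big_split/=; apply: lee_sum => k _.
apply: (@le_trans _ _
  ((keep_fraction P k)%:num%:E * \int[P]_(x in A k) (mdist x (y k))%:E +
   (move_fraction P k)%:num%:E *
    (\int[P]_(x in A k) (mdist x (y k))%:E + r%:E * P (A k)))).
  apply: leeD => //; apply: lee_wpmul2l.
    by rewrite lee_fin; exact: move_fraction_ge0.
  rewrite -(integral_cst P (mA k)) -ge0_integralD//.
  apply: ge0_le_integral => //; first exact: emeasurable_funD.
  by move=> x Ax; rewrite -EFinD lee_fin yr.
have I0 : 0 <= \int[P]_(x in A k) (mdist x (y k))%:E by exact: integral_ge0.
set I := \int[P]_(x in A k) (mdist x (y k))%:E in I0 *.
rewrite (ge0_muleDr _ I0) ?mule_ge0// addeA -ge0_muleDl; last 2 first.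
- by rewrite lee_fin; exact: keep_fraction_ge0.
- by rewrite lee_fin; exact: move_fraction_ge0.
rewrite -EFinD keep_move mul1e massE muleCA -!EFinM move_fractionE leeD2l//.
by rewrite lee_fin ler_wpM2l// mass_sub_coarse.
Qed.

Lemma rounding_plan_first_moment P :
  finite_first_moment (second_marginal (rounding_plan P)).
Proof.
exists a.
have da := measurable_mdistl a.
have d0 (z : S) : 0 <= (mdist a z)%:E by rewrite lee_fin mdist_ge0.
have cpl : couplings P (second_marginal (rounding_plan P)) (rounding_plan P).
  exact: rounding_plan_coupling.
rewrite (coupling_integral_snd cpl)//.
rewrite ge0_integral_splitting_plan//; last first.
  exact: measurableT_comp da (@measurable_snd_borel S).
have fin z (c : {nonneg R}) k :
    (c%:num)%:E * \int[P]_(x in A k) (mdist a z)%:E < +oo.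
  by rewrite (integral_cst P (mA k)) [X in _ * (_ * X)]massE -!EFinM ltry.
by rewrite lte_add_pinfty//; apply: lte_sum_pinfty => k _; exact: fin.
Qed.

End quantization.

(** * The upper bound for tight sets *)

Lemma finite_representatives (T : choiceType) (F : finType) (code : T -> F)
    (G : set T) :
  exists2 G' : set T, finite_set G' &
    forall x, G x -> exists2 x', G' x' & code x = code x'.
Proof.
have [[x0 Gx0]|G0] := pselect (exists x, G x); last first.
  by exists set0 => // x Gx; case: G0; exists x.
pose rep i := xget x0 (G `&` code @^-1` [set i]).
have repP x : G x -> (G `&` code @^-1` [set code x]) (rep (code x)).
  move=> Gx.
  by apply: (@xgetPex _ x0 (G `&` code @^-1` [set code x])); exists x.
exists (rep @` (code @` G)); first exact/finite_image/finite_finset.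
move=> x Gx.
by exists (rep (code x)); [exists (code x) => //; exists x|case: (repP x Gx)].
Qed.

(** Pigeonhole on the rounded masses: for each tuple of values that they take on
    Gamma, one target built from a representative serves all measures in Gamma
    with that tuple. *)
Lemma finite_quantization (R : realType) (S : completeMetricType R)
    (Gamma : set (borel_probability R S))
    (A : nat -> set (borel S)) (m : nat) (y : nat -> S)
    (a : S) (N : nat) (r : R) :
  (forall k, measurable (A k)) -> trivIset [set: nat] A ->
  \big[setU/set0]_(k < m) A k = setT -> (0 <= r)%R ->
  (forall k, (k < m)%N ->
    forall x, A k x -> (mdist x a <= mdist x (y k) + r)%R) ->
  exists Phi : set (borel_probability R S),
    (finite_set Phi /\ Phi `<=` @finite_first_moment R S) /\
    forall P, Gamma P -> exists2 Q, Phi Q &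
      wasserstein P Q <= \sum_(k < m) \int[P]_(x in A k) (mdist x (y k))%:E
                         + (m%:R * (r / N.+1%:R))%:E.
Proof.
move=> mA tA cA r0 yr.
pose plan P := rounding_plan mA y a tA cA N P.
(* Levels are at most N + 1, so the default value of [inord] never occurs. *)
pose code P : {ffun 'I_m -> 'I_N.+2} :=
  [ffun k : 'I_m => inord (mass_level A N P k)].
have [G' finG' G'P] := finite_representatives code Gamma.
exists [set second_marginal (plan P) | P in G']; split.
  split; first exact: finite_image.
  by move=> _ [P _ <-]; exact: rounding_plan_first_moment.
move=> P GP; have [P' G'P' codeP] := G'P _ GP.
exists (second_marginal (plan P')); first by exists P'.
apply: le_trans (rounding_plan_cost mA tA cA N P r0 yr).
apply: ge_ereal_inf; eexists; last exact: lexx.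
exists (plan P) => //; apply: rounding_plan_coupling => k km.
move/ffunP/(_ (Ordinal km)): codeP; rewrite !ffunE => /(congr1 val)/=.
by rewrite !inordK// ltnS mass_level_le.
Qed.

Lemma compact_finite_net (R : realType) (S : completeMetricType R) (K : set S)
    (e : R) : compact K -> (0 < e)%R ->
  exists s : seq S, forall x, K x -> exists2 c, c \in s & (mdist c x <= e)%R.
Proof.
rewrite compact_cover => cK e0.
have [|x _|s _ sK] := cK S setT (fun c => (ball c e)^°).
- by move=> c _; exact: open_interior.
- by exists x => //; exact: nbhsx_ballx.
exists s => x /sK[c cs /interior_subset]; rewrite ballEmdist => /ltW cx.
by exists c.
Qed.

Lemma metric_bounded_radius (R : realType) (S : completeMetricType R)
    (B : set S) (a : S) : metric_bounded B ->
  exists2 r : R, (0 <= r)%R & forall x, B x -> (mdist a x <= r)%R.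
Proof.
move=> [M BM]; have [[b Bb]|B0] := pselect (exists x, B x); last first.
  by exists 0%R => // x Bx; case: B0; exists x.
have M0 : (0 <= M)%R by rewrite -(mdistxx b) BM.
exists (mdist a b + M)%R => [|x Bx]; first by rewrite addr_ge0// mdist_ge0.
by rewrite (le_trans (metric_triangle a b x))// lerD2l BM.
Qed.

Lemma compact_borel_measurable (R : realType) (S : completeMetricType R)
    (K : set S) :
  compact K -> measurable (K : set (borel S)).
Proof.
move=> /(compact_closed (@metric_hausdorff R S)) /closed_openC oK.
by rewrite -(setCK K); apply: measurableC; exact: open_borel_measurable.
Qed.

Lemma hausdorff_le_nonuniform_integrability (R : realType)
    (S : completeMetricType R) (Gamma : set (borel_probability R S)) :
  tight Gamma ->
  hausdorff_noncompactness Gamma <= nonuniform_integrability Gamma.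
Proof.
move=> tightG.
apply: le_ereal_inf_tmp => _ [a _ <-].
apply: le_ereal_inf_tmp => _ [B [bB mB] <-].
set u := nonneg_sup _.
have := nonneg_sup_ge0 _ : 0 <= u.
have uub P : Gamma P -> \int[P]_(x in ~` B) (mdist a x)%:E <= u.
  by move=> GP; apply: nonneg_sup_ub; exists P.
case: u uub => [c| |] uub //; last by move=> _; rewrite leey.
rewrite lee_fin => c0; apply/lee_addgt0Pr => e e0.
have e3 : (0 < e / 3)%R by rewrite divr_gt0.
have [r r0 Br] := metric_bounded_radius a bB.
have r1 : (0 < r + 1)%R by rewrite ltr_wpDl.
have [K cK KP] := tightG (e / 3 / (r + 1))%R (divr_gt0 e3 r1).
have [s sK] := compact_finite_net cK e3.
(* The last piece A_n is what the balls miss; its target is y_n = a, obtained as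
   the default value of [nth] at index n = size s. *)
pose n := size s.
pose F k := if (k < n)%N
  then B `&` [set x : borel S | (mdist (nth a s k) x <= e / 3)%R] else setT.
have mF k : measurable (F k).
  rewrite /F; case: ifP => // _.
  by apply: measurableI => //; exact: measurable_mdist_le.
pose A := seqDU F.
have mA k : measurable (A k) by exact: seqDU_measurable.
have tA : trivIset [set: nat] A by exact: trivIset_seqDU.
have cA : \big[setU/set0]_(k < n.+1) A k = setT.
  by rewrite -bigsetU_seqDU big_ord_recr/= {2}/F ltnn setUT.
have AF k : (k < n)%N ->
    A k `<=` B `&` [set x | (mdist (nth a s k) x <= e / 3)%R].
  by move=> kn x Akx; have := @subset_seqDU _ F k x Akx; rewrite /F kn.
have yr k : (k < n.+1)%N -> forall x, A k x ->
    (mdist x a <= mdist x (nth a s k) + r)%R.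
  rewrite ltnS leq_eqVlt => /predU1P[-> x _|kn x /(AF _ kn)[Bx _]].
    by rewrite nth_default// lerDl.
  by rewrite metric_sym (le_trans (Br _ Bx))// lerDr mdist_ge0.
(* The surpluses of n + 1 pieces, each costing at most r / (N + 1) more, add up
   to at most e / 3. *)
pose N := Num.trunc (n.+1%:R * r / (e / 3))%R.
have Nr : (n.+1%:R * (r / N.+1%:R) <= e / 3)%R.
  rewrite mulrA ler_pdivrMr// [leRHS]mulrC -ler_pdivrMr//.
  by rewrite ltW// truncnS_gt.
have [Phi [Phi1 PhiP]] := finite_quantization Gamma N mA tA cA r0 yr.
apply: ge_ereal_inf; eexists; first by exists Phi.
apply: nonneg_sup_le => [|_ [P GP <-]].
  by rewrite adde_ge0// lee_fin// ltW.
have [Q PhiQ PQ] := PhiP _ GP.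
apply: ge_ereal_inf; eexists; first by exists Q.
apply: (le_trans PQ).
have dm (z : S) D : measurable_fun D (fun x : borel S => (mdist x z)%:E).
  apply: measurable_funTS; under eq_fun do rewrite metric_sym.
  exact: measurable_mdistl.
have d0 (x z : S) : 0 <= (mdist x z)%:E by rewrite lee_fin mdist_ge0.
have near_part :
    \sum_(k < n) \int[P]_(x in A k) (mdist x (nth a s k))%:E <= (e / 3)%:E.
  apply: (@le_trans _ _ (\sum_(k < n) (e / 3)%:E * P (A k))).
    apply: lee_sum => k _; rewrite -(integral_cst P (mA k)).
    apply: ge0_le_integral => // x /(AF _ (ltn_ord k))[_ xk].
    by rewrite lee_fin metric_sym.
  rewrite -ge0_sume_distrr// -(measure_bigsetU P mA tA).
  rewrite -[leRHS]mule1 lee_pmul2l//; apply: probability_le1.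
  exact: bigsetU_measurable.
(* Split A_n along B: outside B the tail bound applies, inside B the points are
   within r of a and outside K. *)
have far_part : \int[P]_(x in A n) (mdist x a)%:E <= c%:E + (e / 3)%:E.
  have AnK : A n `&` B `<=` ~` K.
    move=> x [[_ Fx] Bx] /sK[z zs zx]; apply: Fx; rewrite -bigcup_mkord.
    have zn : (index z s < n)%N by rewrite index_mem.
    by exists (index z s) => //; rewrite /F zn; split; rewrite //= nth_index.
  have mKC : measurable (~` K : set (borel S)).
    by apply: measurableC; exact: (compact_borel_measurable cK).
  have mAnB : measurable (A n `&` B) by exact: measurableI.
  have mAnCB : measurable (A n `&` ~` B).
    exact: measurableI (mA n) (measurableC mB).
  rewrite -(setIT (A n)) -(setvU B) setIUr.
  rewrite ge0_integral_setU//; last by apply/disj_setPS => x [[_ ?] []].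
  apply: leeD.
    apply: le_trans (uub P GP).
    under [leRHS]eq_integral do rewrite metric_sym.
    by apply: ge0_subset_integral => //; exact: measurableC.
  apply: (@le_trans _ _ (r%:E * P (A n `&` B))).
    rewrite -(integral_cst P mAnB); apply: ge0_le_integral => // x [_ Bx].
    by rewrite lee_fin metric_sym Br.
  apply: (@le_trans _ _ (r%:E * (e / 3 / (r + 1))%:E)).
    apply: lee_wpmul2l => //; apply: (le_trans _ (ltW (KP P GP))).
    by apply: le_measure; [exact: mem_set|exact: mem_set|exact: AnK].
  rewrite -EFinM lee_fin mulrCA ler_piMr ?ltW//.
  by rewrite ltr_pdivrMr// mul1r ltrDl.
rewrite big_ord_recr/= nth_default//.
have -> : c%:E + e%:E = (e / 3)%:E + (c%:E + (e / 3)%:E) + (e / 3)%:E.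
  by rewrite -!EFinD; congr EFin; field.
by apply: leeD; [exact: leeD|rewrite lee_fin].
Qed.

Theorem theorem4p4 (R : realType) (S : completeMetricType R)
    (sepS : separable S) (Gamma : set (borel_probability R S))
    (Gamma_P1 : Gamma `<=` @finite_first_moment R S) :
  (nonuniform_integrability Gamma <= hausdorff_noncompactness Gamma)%E /\
  (tight Gamma ->
     nonuniform_integrability Gamma = hausdorff_noncompactness Gamma).
Proof.
split=> [|tightG]; first exact: nonuniform_integrability_le_hausdorff.
apply/eqP; rewrite eq_le nonuniform_integrability_le_hausdorff/=.
exact: hausdorff_le_nonuniform_integrability.
Qed.
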